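(* $$\frac{6}{17-18G}=\mathrm{CF}\left[3n^2+13n+13,\,-2n(n+1)^2(n+3)\right],$$ where $G$ is Catalan's constant.
   Context: For sequences $(a_n)_{n\ge0}$, $(b_n)_{n\ge1}$, $\mathrm{CF}[a_n,b_n]$ denotes the continued fraction $a_0+\cfrac{b_1}{a_1+\cfrac{b_2}{a_2+\ddots}}$, whose value is $\lim_{n\to\infty}A_n/B_n$, where $A_0=1$, $A_1=a_0$, $B_0=0$, $B_1=1$, and $A_{n+1}=a_nA_n+b_nA_{n-1}$, $B_{n+1}=a_nB_n+b_nB_{n-1}$ for $n\ge1$. Catalan's constant is $G=\sum_{k=0}^\infty \frac{(-1)^k}{(2k+1)^2}$. *)

(* Defs.v *)
From Stdlib Require Import Reals.
From Coquelicot Require Import Coquelicot.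
Open Scope R_scope.

(** [a] is indexed from 0 and [b] from 1: the value [b 0] is never used. *)
Fixpoint cf_num (a b : nat -> R) (n : nat) : R :=
  match n with
  | O => 1
  | S m =>
      match m with
      | O => a O
      | S p => a m * cf_num a b m + b m * cf_num a b p
      end
  end.

Fixpoint cf_den (a b : nat -> R) (n : nat) : R :=
  match n with
  | O => 0
  | S m =>
      match m with
      | O => 1
      | S p => a m * cf_den a b m + b m * cf_den a b p
      end
  end.

(** Division is total on [R], so we also require the quotients to be
    meaningful from some rank on; [cf_den a b 0 = 0] rules out asking it for
    every [n]. *)
Definition is_CF (a b : nat -> R) (l : R) : Prop :=
  eventually (fun n => cf_den a b n <> 0) /\
  is_lim_seq (fun n => cf_num a b n / cf_den a b n) l.

Definition Catalan : R :=
  Series (fun k => (-1) ^ k / (2 * INR k + 1) ^ 2).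

(* Main.v *)
(** Let K be the complete elliptic integral of the first kind and
    [J_m = int_0^1 (1 - v)^m K(v) dv].  Then [J_0 = 2G], [J_1 = 2G - 1], and [J]
    is a positive decreasing solution of
    [(m+1)^2 J_(m+1) = (3m^2+3m+1) J_m - 2m^2 J_(m-1)].
    A contiguous combination [c_m] of [J_m] and [J_(m+1)] with polynomial
    coefficients satisfies [(17 - 18G) A_n - 6 B_n = n! (n+1)! c_(n+1)].  This
    is polynomially bounded after division by [n! (n+1)!], whereas
    [B_n / (n! (n+1)!)] grows at least like [(3/2)^n], so
    [A_n / B_n -> 6 / (17 - 18G)].  Integrals are avoided by
    expanding K in powers of [v^2]: the facts about [J] become telescoping sums. *)
Require Import Defs.
From Stdlib Require Import Reals Lra Lia.
From Coquelicot Require Import Coquelicot.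
Open Scope R_scope.

(** * Limits and telescoping series *)

Lemma is_lim_seq_scal_finite (u : nat -> R) (c l : R) :
  is_lim_seq u l -> is_lim_seq (fun n => c * u n) (c * l).
Proof.
  intros Hu. apply is_lim_seq_mult'; [apply is_lim_seq_const | exact Hu].
Qed.

Lemma is_series_telescope (a T : nat -> R) (l : R) :
  (forall i, a i = T (S i) - T i) -> is_lim_seq T l -> is_series a (l - T O).
Proof.
  intros Ha HT.
  assert (Hsum : forall n, sum_n a n = T (S n) - T O).
  { induction n as [|n IH].
    - rewrite sum_O. apply Ha.
    - rewrite sum_Sn, IH, Ha. unfold plus; simpl. ring. }
  change (is_lim_seq (sum_n a) (l - T O)).
  apply is_lim_seq_ext with (fun n => T (S n) - T O).
  - intros n. now rewrite Hsum.
  - apply is_lim_seq_minus'.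
    + now apply is_lim_seq_incr_1 in HT.
    + apply is_lim_seq_const.
Qed.

Lemma is_series_combine3 (a b c : nat -> R) (x y z la lb lc : R) :
  is_series a la -> is_series b lb -> is_series c lc ->
  is_series (fun i => x * a i + y * b i + z * c i) (x * la + y * lb + z * lc).
Proof.
  intros Ha Hb Hc.
  apply (is_series_plus (fun i => x * a i + y * b i) (fun i => z * c i)).
  - apply (is_series_plus (fun i => x * a i) (fun i => y * b i)).
    + now apply (is_series_scal x a).
    + now apply (is_series_scal y b).
  - now apply (is_series_scal z c).
Qed.

Lemma Series_nonneg (a : nat -> R) :
  (forall n, 0 <= a n) -> ex_series a -> 0 <= Series a.
Proof.
  intros Ha Hex.
  replace 0 with (Series (fun n => 0 * a n)) by (rewrite Series_scal_l; ring).
  apply Series_le; [intros n; specialize (Ha n); lra | exact Hex].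
Qed.

(** * Squared normalised central binomial coefficients *)

(* [central_sq i = (C(2i,i) / 4^i)^2], so that [K(v) = PI/2 * sum_i central_sq i * v^(2i)]. *)
Fixpoint central_sq (i : nat) : R :=
  match i with
  | O => 1
  | S j => central_sq j * ((2 * INR j + 1) / (2 * INR j + 2)) ^ 2
  end.

Lemma central_sq_S (i : nat) :
  central_sq (S i) = central_sq i * ((2 * INR i + 1) / (2 * INR i + 2)) ^ 2.
Proof. reflexivity. Qed.

Lemma central_sq_pos (i : nat) : 0 < central_sq i.
Proof.
  induction i as [|i IH]; [simpl; lra|]. rewrite central_sq_S.
  pose proof (pos_INR i).
  apply Rmult_lt_0_compat; [exact IH|].
  apply pow_lt, Rdiv_lt_0_compat; lra.
Qed.

(** Passing from [i] to [i + 1] multiplies the left side by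
    [(2i+1)(2i+3)/(2i+2)^2 = 1 - 1/(2i+2)^2], so it decreases from its initial value 1. *)
Lemma central_sq_le (i : nat) : (2 * INR i + 1) * central_sq i <= 1.
Proof.
  induction i as [|i IH]; [simpl; lra|].
  rewrite S_INR, central_sq_S.
  pose proof (pos_INR i). pose proof (central_sq_pos i).
  replace ((2 * (INR i + 1) + 1) * (central_sq i * ((2 * INR i + 1) / (2 * INR i + 2)) ^ 2))
    with ((2 * INR i + 1) * central_sq i * (1 - 1 / (2 * INR i + 2) ^ 2)) by (field; lra).
  assert (0 < 1 / (2 * INR i + 2) ^ 2)
    by (apply Rdiv_lt_0_compat; [lra | apply pow_lt; lra]).
  assert (0 < (2 * INR i + 1) * central_sq i) by nra.
  nra.
Qed.

(** Rests on [(2i+1)^2 - 4i(i+1) = 1]. The positive increment makes [i * central_sq i] increasing;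
    it also provides a summable majorant for the moments and the telescoping part of [moment_1]. *)
Lemma central_sq_step (i : nat) :
  INR (S i) * central_sq (S i) - INR i * central_sq i = central_sq i / (4 * (INR i + 1)).
Proof.
  rewrite S_INR, central_sq_S. pose proof (pos_INR i). field. lra.
Qed.

(** By Wallis the constant is [1/PI]. It stays abstract and cancels once the moments are divided by
    [2 * lam]. *)
Lemma central_sq_asymptotic :
  exists lam : R, 0 < lam /\ is_lim_seq (fun i => INR i * central_sq i) lam.
Proof.
  assert (Hincr : forall i, INR i * central_sq i <= INR (S i) * central_sq (S i)).
  { intros i. pose proof (central_sq_step i). pose proof (central_sq_pos i).
    pose proof (pos_INR i).
    assert (0 < central_sq i / (4 * (INR i + 1))) by (apply Rdiv_lt_0_compat; lra). lra. }
  destruct (ex_finite_lim_seq_incr (fun i => INR i * central_sq i) 1 Hincr) as [l Hl].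
  { intros i. pose proof (central_sq_le i). pose proof (central_sq_pos i).
    pose proof (pos_INR i). nra. }
  exists l. split; [|exact Hl].
  (* An increasing sequence stays below its limit, and the term at index 1 is 1/4. *)
  pose proof (is_lim_seq_incr_compare _ l Hl Hincr 1%nat) as H1.
  simpl in H1. lra.
Qed.

(** * The moments *)

(* Beta function: [beta m i = m! (2i)! / (2i+m+1)! = int_0^1 v^(2i) (1-v)^m dv]. *)
Fixpoint beta (m i : nat) : R :=
  match m with
  | O => 1 / (2 * INR i + 1)
  | S k => beta k i * ((INR k + 1) / (2 * INR i + INR k + 2))
  end.

Lemma beta_0 (i : nat) : beta 0 i = 1 / (2 * INR i + 1).
Proof. reflexivity. Qed.

Lemma beta_S (m i : nat) :
  beta (S m) i = beta m i * ((INR m + 1) / (2 * INR i + INR m + 2)).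
Proof. reflexivity. Qed.

Definition moment_term (m i : nat) : R := central_sq i * beta m i.

Definition moment (m : nat) : R := Series (moment_term m).

Lemma beta_pos (m i : nat) : 0 < beta m i.
Proof.
  pose proof (pos_INR i).
  induction m as [|m IH]; rewrite ?beta_S, ?beta_0.
  - apply Rdiv_lt_0_compat; lra.
  - pose proof (pos_INR m).
    apply Rmult_lt_0_compat; [exact IH | apply Rdiv_lt_0_compat; lra].
Qed.

Lemma beta_decr (m i : nat) : beta (S m) i <= beta m i.
Proof.
  rewrite ?beta_S, ?beta_0.
  pose proof (pos_INR i). pose proof (pos_INR m). pose proof (beta_pos m i).
  assert ((INR m + 1) / (2 * INR i + INR m + 2) <= 1).
  { apply Rmult_le_reg_r with (2 * INR i + INR m + 2); [lra|].
    unfold Rdiv. rewrite Rmult_assoc, Rinv_l by lra. lra. }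
  nra.
Qed.

Lemma beta_step (m i : nat) :
  beta m (S i) * ((2 * INR i + INR m + 2) * (2 * INR i + INR m + 3))
  = beta m i * ((2 * INR i + 1) * (2 * INR i + 2)).
Proof.
  pose proof (pos_INR i).
  induction m as [|m IH].
  - rewrite ?beta_S, ?beta_0. rewrite S_INR. simpl INR. field. lra.
  - pose proof (pos_INR m). rewrite ?beta_S, ?beta_0. rewrite !S_INR.
    apply Rmult_eq_reg_r with (2 * INR i + INR m + 2); [|lra].
    transitivity (beta m (S i) * ((2 * INR i + INR m + 2) * (2 * INR i + INR m + 3))
                  * (INR m + 1)).
    + field. lra.
    + rewrite IH. field. lra.
Qed.

Lemma moment_term_pos (m i : nat) : 0 < moment_term m i.
Proof. apply Rmult_lt_0_compat; [apply central_sq_pos | apply beta_pos]. Qed.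

Lemma moment_term_decr (m i : nat) : moment_term (S m) i <= moment_term m i.
Proof.
  apply Rmult_le_compat_l; [apply Rlt_le, central_sq_pos | apply beta_decr].
Qed.

(** For [m = 0], the bound [1/(2i+1) <= 1/(i+1)] compares the terms with four times the increments
    of [i * central_sq i], which telescope. Larger [m] only decreases the terms. *)
Lemma ex_series_moment_term (m : nat) : ex_series (moment_term m).
Proof.
  induction m as [|m IH].
  - destruct central_sq_asymptotic as [lam [_ Hlam]].
    apply (ex_series_le (moment_term 0)
      (fun i => 4 * (INR (S i) * central_sq (S i) - INR i * central_sq i))).
    + intros i. change (norm (moment_term 0 i)) with (Rabs (moment_term 0 i)).
      rewrite Rabs_pos_eq by (apply Rlt_le, moment_term_pos).
      rewrite central_sq_step. unfold moment_term. rewrite ?beta_S, ?beta_0.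
      pose proof (central_sq_pos i). pose proof (pos_INR i).
      replace (4 * (central_sq i / (4 * (INR i + 1)))) with (central_sq i * (1 / (INR i + 1)))
        by (field; lra).
      apply Rmult_le_compat_l; [lra|].
      apply Rmult_le_compat_l; [lra|]. apply Rinv_le_contravar; lra.
    + exists (4 * lam - 4 * (INR 0 * central_sq 0)).
      apply (is_series_telescope _ (fun i => 4 * (INR i * central_sq i))).
      * intros i. ring.
      * now apply is_lim_seq_scal_finite.
  - apply (ex_series_le (moment_term (S m)) (moment_term m)); [|exact IH].
    intros i. change (norm (moment_term (S m) i)) with (Rabs (moment_term (S m) i)).
    rewrite Rabs_pos_eq by (apply Rlt_le, moment_term_pos).
    apply moment_term_decr.
Qed.

Lemma is_series_moment (m : nat) : is_series (moment_term m) (moment m).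
Proof. apply Series_correct, ex_series_moment_term. Qed.

Lemma moment_nonneg (m : nat) : 0 <= moment m.
Proof.
  apply Series_nonneg; [intros i; apply Rlt_le, moment_term_pos|].
  apply ex_series_moment_term.
Qed.

Lemma moment_le (m : nat) : moment m <= moment 0.
Proof.
  induction m as [|m IH]; [lra|].
  apply Rle_trans with (moment m); [|exact IH].
  apply Series_le; [|apply ex_series_moment_term].
  intros i. split; [apply Rlt_le, moment_term_pos | apply moment_term_decr].
Qed.

(** Creative telescoping in [i], with certificate [-2i(m+1)]: every term is a rational multiple of
    [moment_term m i], so the identity is one of rational functions. *)
Lemma moment_term_telescope (m i : nat) :
  (INR m + 2) ^ 2 * moment_term (S (S m)) i
  + - (3 * INR m ^ 2 + 9 * INR m + 7) * moment_term (S m) i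
  + 2 * (INR m + 1) ^ 2 * moment_term m i
  = - (INR m + 1) * (2 * INR (S i)) * moment_term m (S i)
    - - (INR m + 1) * (2 * INR i) * moment_term m i.
Proof.
  pose proof (pos_INR i). pose proof (pos_INR m).
  unfold moment_term. rewrite ?beta_S, ?beta_0. rewrite central_sq_S, !S_INR.
  replace (beta m (S i)) with
    (beta m i * ((2 * INR i + 1) * (2 * INR i + 2))
      / ((2 * INR i + INR m + 2) * (2 * INR i + INR m + 3)))
    by (rewrite <- beta_step; field; lra).
  field. lra.
Qed.

(** Removes the boundary term at infinity in [moment_rec]. Since [i/(2i+1) <= 1], the sequence is
    dominated by [central_sq i], which is O(1/i). *)
Lemma lim_moment_term (m : nat) : is_lim_seq (fun i => INR i * moment_term m i) 0.
Proof.
  destruct central_sq_asymptotic as [lam [_ Hlam]].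
  assert (Hp : is_lim_seq central_sq 0).
  { apply is_lim_seq_le_le with (fun _ => 0) (fun i => / (INR i + 1)).
    - intros i. pose proof (central_sq_pos i). pose proof (central_sq_le i).
      pose proof (pos_INR i).
      split; [lra|].
      apply Rmult_le_reg_r with (INR i + 1); [lra|]. rewrite Rinv_l by lra. nra.
    - apply is_lim_seq_const.
    - apply is_lim_seq_ext with (fun i => / INR (S i)).
      { intros i. now rewrite S_INR. }
      apply (is_lim_seq_incr_1 (fun i => / INR i)).
      apply (is_lim_seq_inv INR p_infty); [apply is_lim_seq_INR | discriminate]. }
  apply is_lim_seq_le_le with (fun _ => 0) central_sq; [|apply is_lim_seq_const | exact Hp].
  intros i. pose proof (pos_INR i). pose proof (central_sq_pos i).
  pose proof (moment_term_pos m i).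
  split; [nra|].
  assert (Hm : moment_term m i <= moment_term 0 i).
  { clear. induction m as [|m IH]; [lra|].
    eapply Rle_trans; [apply moment_term_decr | exact IH]. }
  apply Rle_trans with (INR i * moment_term 0 i); [nra|].
  unfold moment_term. rewrite ?beta_S, ?beta_0.
  apply Rmult_le_reg_r with (2 * INR i + 1); [lra|].
  replace (INR i * (central_sq i * (1 / (2 * INR i + 1))) * (2 * INR i + 1))
    with (INR i * central_sq i) by (field; lra).
  nra.
Qed.

Lemma moment_rec (m : nat) :
  (INR m + 2) ^ 2 * moment (S (S m))
  = (3 * INR m ^ 2 + 9 * INR m + 7) * moment (S m)
    - 2 * (INR m + 1) ^ 2 * moment m.
Proof.
  pose proof (is_series_combine3 _ _ _ ((INR m + 2) ^ 2)
    (- (3 * INR m ^ 2 + 9 * INR m + 7)) (2 * (INR m + 1) ^ 2) _ _ _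
    (is_series_moment (S (S m))) (is_series_moment (S m)) (is_series_moment m)) as H.
  apply is_series_unique in H.
  assert (Hlim : is_lim_seq
    (fun i => - (INR m + 1) * (2 * INR i) * moment_term m i) 0).
  { apply is_lim_seq_ext with
      (fun i => - 2 * (INR m + 1) * (INR i * moment_term m i)); [intros i; ring|].
    replace 0 with (- 2 * (INR m + 1) * 0) by ring.
    apply is_lim_seq_scal_finite, lim_moment_term. }
  pose proof (is_series_telescope _ _ _ (moment_term_telescope m) Hlim) as H'.
  apply is_series_unique in H'.
  (* The boundary term at [i = 0] vanishes through its factor [INR 0]. *)
  rewrite H in H'. simpl (INR 0) in H'. lra.
Qed.

(** [beta 1 i = 1/(2i+1) - 1/(2i+2)]. The second fraction, which corresponds to the integral of
    [v K(v)], contributes a telescoping sum by [central_sq_step]. *)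
Lemma moment_1 (lam : R) :
  is_lim_seq (fun i => INR i * central_sq i) lam -> moment 1 = moment 0 - 2 * lam.
Proof.
  intros Hlam.
  assert (H : is_series
    (fun i => 2 * (INR (S i) * central_sq (S i) - INR i * central_sq i)) (2 * lam)).
  { replace (2 * lam) with (2 * lam - 2 * (INR 0 * central_sq 0)) by (simpl; ring).
    apply (is_series_telescope _ (fun i => 2 * (INR i * central_sq i))).
    - intros i. ring.
    - now apply is_lim_seq_scal_finite. }
  assert (Hext : forall i,
    moment_term 0 i - 2 * (INR (S i) * central_sq (S i) - INR i * central_sq i)
    = moment_term 1 i).
  { intros i. rewrite central_sq_step. unfold moment_term. rewrite ?beta_S, ?beta_0. simpl INR.
    pose proof (pos_INR i). field. lra. }
  apply is_series_unique.
  apply (is_series_ext _ _ _ Hext).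
  apply (is_series_minus _ _ _ _ (is_series_moment 0) H).
Qed.

(** * The zeroth moment *)

(* [twisted N i = central_sq i / (2i+1) * C(2i,i-N) / C(2i,i)], which vanishes for [i < N];
   its sum over [i] is, up to a constant factor,
   [(-1)^N * int_0^(PI/2) t * cos(2Nt) / sin t dt]. *)
Fixpoint twisted (N i : nat) : R :=
  match N with
  | O => central_sq i * (1 / (2 * INR i + 1))
  | S k => twisted k i * ((INR i - INR k) / (INR i + INR k + 1))
  end.

Lemma twisted_0 (i : nat) : twisted 0 i = central_sq i * (1 / (2 * INR i + 1)).
Proof. reflexivity. Qed.

Lemma twisted_S (N i : nat) :
  twisted (S N) i = twisted N i * ((INR i - INR N) / (INR i + INR N + 1)).
Proof. reflexivity. Qed.

Lemma twisted_eq_0 (N i : nat) : (i < N)%nat -> twisted N i = 0.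
Proof.
  induction N as [|N IH]; intros Hi; [lia|]. rewrite ?twisted_S, ?twisted_0.
  destruct (Nat.eq_dec i N) as [->|Hne].
  - unfold Rdiv. ring.
  - rewrite IH by lia. ring.
Qed.

Lemma twisted_bounds (N i : nat) : 0 <= twisted N i <= moment_term 0 i.
Proof.
  induction N as [|N IH].
  - pose proof (moment_term_pos 0 i). change (twisted 0 i) with (moment_term 0 i). lra.
  - destruct (Nat.lt_ge_cases i (S N)) as [Hlt|Hge].
    + rewrite twisted_eq_0 by exact Hlt. pose proof (moment_term_pos 0 i). lra.
    + rewrite ?twisted_S, ?twisted_0. apply le_INR in Hge. rewrite S_INR in Hge.
      pose proof (pos_INR N).
      assert (0 <= (INR i - INR N) / (INR i + INR N + 1)).
      { apply Rdiv_le_0_compat; lra. }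
      assert ((INR i - INR N) / (INR i + INR N + 1) <= 1).
      { apply Rmult_le_reg_r with (INR i + INR N + 1); [lra|].
        unfold Rdiv. rewrite Rmult_assoc, Rinv_l by lra. lra. }
      nra.
Qed.

Lemma ex_series_twisted (N : nat) : ex_series (twisted N).
Proof.
  apply (ex_series_le (twisted N) (moment_term 0)); [|apply ex_series_moment_term].
  intros i. change (norm (twisted N i)) with (Rabs (twisted N i)).
  pose proof (twisted_bounds N i). rewrite Rabs_pos_eq; lra.
Qed.

(** The ratio of consecutive terms in [i], kept in product form because the factor [i + 1 - N] can
    vanish. *)
Lemma twisted_step (N i : nat) :
  twisted N (S i) * ((2 * INR i + 3) * (INR i + 1 - INR N) * (INR i + 1 + INR N))
  = twisted N i * ((2 * INR i + 1) * (INR i + 1 / 2) ^ 2).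
Proof.
  pose proof (pos_INR i).
  induction N as [|N IH].
  - rewrite ?twisted_S, ?twisted_0, central_sq_S, S_INR. simpl INR. field. lra.
  - pose proof (pos_INR N). rewrite ?twisted_S, ?twisted_0, !S_INR.
    transitivity (twisted N (S i)
      * ((2 * INR i + 3) * (INR i + 1 - INR N) * (INR i + 1 + INR N))
      * ((INR i - INR N) / (INR i + INR N + 1))).
    + field. lra.
    + rewrite IH. field. lra.
Qed.

(** Both sides equal [twisted N i * (2i+1)/(i+N+1)], by [(i+1/2)^2 - (i-N)(i+N+1) = (N+1/2)^2]. *)
Lemma twisted_telescope (N i : nat) :
  twisted N i + twisted (S N) i
  = 4 / (2 * INR N + 1) ^ 2 * (twisted N (S i) * (2 * INR (S i) + 1) * (INR (S i) - INR N))
    - 4 / (2 * INR N + 1) ^ 2 * (twisted N i * (2 * INR i + 1) * (INR i - INR N)).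
Proof.
  pose proof (pos_INR i). pose proof (pos_INR N).
  replace (twisted N (S i) * (2 * INR (S i) + 1) * (INR (S i) - INR N)) with
    (twisted N i * ((2 * INR i + 1) * (INR i + 1 / 2) ^ 2) / (INR i + 1 + INR N)).
  - rewrite ?twisted_S, ?twisted_0. field. lra.
  - rewrite <- twisted_step, S_INR. field. lra.
Qed.

Lemma is_lim_seq_homographic (x y : R) :
  is_lim_seq (fun i => (INR i - x) / (INR i + y)) 1.
Proof.
  apply is_lim_seq_ext_loc with (fun i => 1 - (x + y) * / (INR i + y)).
  (* A rank beyond [Rabs y], since [INR i + y] may vanish earlier. *)
  - destruct (nfloor_ex (Rabs y) (Rabs_pos y)) as [M HM].
    exists (S M). intros i Hi. apply le_INR in Hi. rewrite S_INR in Hi.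
    assert (- y <= Rabs y) by (rewrite <- Rabs_Ropp; apply Rle_abs).
    field. lra.
  - replace (Finite 1) with (Finite (1 - (x + y) * 0)) by (f_equal; ring).
    apply is_lim_seq_minus'; [apply is_lim_seq_const|].
    apply is_lim_seq_scal_finite.
    apply (is_lim_seq_inv _ p_infty); [|discriminate].
    apply is_lim_seq_plus with p_infty y;
      [apply is_lim_seq_INR | apply is_lim_seq_const | reflexivity].
Qed.

(** Raising [N] by one multiplies the sequence by [(i-N-1)/(i+N+1)], which tends to 1, so the limit
    does not depend on [N]. *)
Lemma lim_twisted (lam : R) (N : nat) :
  is_lim_seq (fun i => INR i * central_sq i) lam ->
  is_lim_seq (fun i => twisted N i * (2 * INR i + 1) * (INR i - INR N)) lam.
Proof.
  intros Hlam.
  induction N as [|N IH].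
  - apply is_lim_seq_ext with (fun i => INR i * central_sq i); [|exact Hlam].
    intros i. simpl. pose proof (pos_INR i). field. lra.
  - apply is_lim_seq_ext with
      (fun i => twisted N i * (2 * INR i + 1) * (INR i - INR N)
                * ((INR i - INR (S N)) / (INR i + INR (S N)))).
    + intros i. rewrite ?twisted_S, ?twisted_0, !S_INR.
      pose proof (pos_INR i). pose proof (pos_INR N). field. lra.
    + replace lam with (lam * 1) by ring.
      apply is_lim_seq_mult'; [exact IH | apply is_lim_seq_homographic].
Qed.

(** Discrete form of [cos(2Nt) - cos(2(N+1)t) = 2 sin t sin((2N+1)t)] integrated against
    [t / sin t]; the alternating sign turns the difference into a sum. *)
Lemma twisted_sum_step (lam : R) (N : nat) :
  is_lim_seq (fun i => INR i * central_sq i) lam ->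
  Series (twisted N) + Series (twisted (S N)) = 4 * lam / (2 * INR N + 1) ^ 2.
Proof.
  intros Hlam. pose proof (pos_INR N).
  rewrite <- Series_plus by apply ex_series_twisted.
  apply is_series_unique.
  replace (4 * lam / (2 * INR N + 1) ^ 2) with
    (4 / (2 * INR N + 1) ^ 2 * lam
     - 4 / (2 * INR N + 1) ^ 2 * (twisted N 0 * (2 * INR 0 + 1) * (INR 0 - INR N))).
  - apply (is_series_telescope _ (fun i =>
      4 / (2 * INR N + 1) ^ 2 * (twisted N i * (2 * INR i + 1) * (INR i - INR N)))).
    + apply twisted_telescope.
    + now apply is_lim_seq_scal_finite, lim_twisted.
  (* The boundary term at [i = 0] is zero: for [N = 0] by the factor [i - N], otherwise because
     [twisted N 0 = 0]. *)
  - destruct N as [|N].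
    + simpl INR. field.
    + rewrite (twisted_eq_0 (S N) 0) by lia. field. lra.
Qed.

(** With [U N] the sum of [twisted N], [U 0] is [moment 0]. The series of [(-1)^N (U N + U (N+1))]
    telescopes to [U 0], while [twisted_sum_step] identifies it with [4 * lam] times Catalan's
    series. Nonnegativity of [U (N+1)] bounds [U N] by [4 * lam / (2N+1)^2], so the boundary term
    tends to 0. *)
Lemma moment_0 (lam : R) :
  is_lim_seq (fun i => INR i * central_sq i) lam -> moment 0 = 4 * lam * Catalan.
Proof.
  intros Hlam.
  set (U := fun N => Series (twisted N)).
  assert (HU : forall N, 0 <= U N).
  { intros N. apply Series_nonneg; [|apply ex_series_twisted].
    intros i. apply twisted_bounds. }
  assert (Hstep : forall N, U N + U (S N) = 4 * lam / (2 * INR N + 1) ^ 2)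
    by (intros N; now apply twisted_sum_step).
  assert (Hlim : is_lim_seq (fun N => - ((-1) ^ N * U N)) 0).
  { assert (Hb : is_lim_seq (fun N => 4 * lam * / INR (S N)) 0).
    { replace 0 with (4 * lam * 0) by ring.
      apply is_lim_seq_scal_finite.
      apply (is_lim_seq_incr_1 (fun i => / INR i)).
      apply (is_lim_seq_inv INR p_infty); [apply is_lim_seq_INR | discriminate]. }
    apply is_lim_seq_abs_0.
    apply is_lim_seq_le_le with (fun _ => 0) (fun N => 4 * lam * / INR (S N));
      [|apply is_lim_seq_const | exact Hb].
    intros N. rewrite Rabs_Ropp, Rabs_mult, pow_1_abs, Rmult_1_l.
    rewrite Rabs_pos_eq by apply HU.
    split; [apply HU|].
    apply Rle_trans with (4 * lam / (2 * INR N + 1) ^ 2).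
    - rewrite <- Hstep. pose proof (HU (S N)). lra.
    - rewrite S_INR. pose proof (pos_INR N).
      assert (0 <= lam).
      { pose proof (Hstep O) as H0. simpl in H0.
        pose proof (HU O). pose proof (HU 1%nat). lra. }
      apply Rmult_le_compat_l; [lra|].
      apply Rinv_le_contravar; nra. }
  assert (HS : is_series (fun N => 4 * lam * ((-1) ^ N / (2 * INR N + 1) ^ 2)) (U O)).
  { replace (U O) with (0 - - ((-1) ^ 0 * U O)) by (simpl; ring).
    apply (is_series_telescope _ (fun N => - ((-1) ^ N * U N))); [|exact Hlim].
    intros N. simpl pow.
    replace (4 * lam * ((-1) ^ N / ((2 * INR N + 1) * ((2 * INR N + 1) * 1))))
      with ((-1) ^ N * (4 * lam / (2 * INR N + 1) ^ 2))
      by (pose proof (pos_INR N); field; lra).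
    rewrite <- Hstep. ring. }
  apply is_series_unique in HS. rewrite Series_scal_l in HS.
  symmetry. exact HS.
Qed.

(** * The convergents *)

(* The two polynomials interpolate the solution of
   [m(m+1) c_(m+1) = (3m^2+7m+3) c_m - 2m(m+2) c_(m-1)], [c_0 = 1], [c_1 = 17 - 18G],
   written over the basis [J_m], [J_(m+1)]. *)
Definition contiguous (J : nat -> R) (m : nat) : R :=
  (INR m ^ 4 + 6 * INR m ^ 3 + 8 * INR m ^ 2 + 5 * INR m + 2) / 2 * J m
  - (INR m + 1) ^ 2 * (INR m ^ 2 + 5 * INR m + 2) / 2 * J (S m).

(** Eliminating [J (m+3)] and [J (m+2)] leaves a combination of [J (m+1)] and [J m] whose two
    coefficients agree as rational functions of [m]. *)
Lemma contiguous_rec (J : nat -> R) (m : nat) :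
  (forall k, (INR k + 2) ^ 2 * J (S (S k))
             = (3 * INR k ^ 2 + 9 * INR k + 7) * J (S k) - 2 * (INR k + 1) ^ 2 * J k) ->
  (INR m + 1) * (INR m + 2) * contiguous J (S (S m))
  = (3 * INR m ^ 2 + 13 * INR m + 13) * contiguous J (S m)
    - 2 * (INR m + 1) * (INR m + 3) * contiguous J m.
Proof.
  intros HJ. pose proof (pos_INR m).
  assert (H2 : J (S (S m)) = ((3 * INR m ^ 2 + 9 * INR m + 7) * J (S m)
                              - 2 * (INR m + 1) ^ 2 * J m) / (INR m + 2) ^ 2).
  { rewrite <- HJ. field. lra. }
  assert (H3 : J (S (S (S m))) = ((3 * (INR m + 1) ^ 2 + 9 * (INR m + 1) + 7) * J (S (S m))
                              - 2 * (INR m + 2) ^ 2 * J (S m)) / (INR m + 3) ^ 2).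
  { pose proof (HJ (S m)) as H3. rewrite S_INR in H3.
    replace (INR m + 2) with (INR m + 1 + 1) by ring.
    rewrite <- H3. field. lra. }
  unfold contiguous. rewrite H3, H2, !S_INR. field. lra.
Qed.

Section Convergents.

Let a (n : nat) : R := 3 * INR n ^ 2 + 13 * INR n + 13.
Let b (n : nat) : R := - 2 * INR n * (INR n + 1) ^ 2 * (INR n + 3).

Lemma cf_num_SS (n : nat) :
  cf_num a b (S (S n)) = a (S n) * cf_num a b (S n) + b (S n) * cf_num a b n.
Proof. reflexivity. Qed.

Lemma cf_den_SS (n : nat) :
  cf_den a b (S (S n)) = a (S n) * cf_den a b (S n) + b (S n) * cf_den a b n.
Proof. reflexivity. Qed.

(* [scale n = n! (n+1)!] *)
Fixpoint scale (n : nat) : R :=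
  match n with
  | O => 1
  | S k => scale k * ((INR k + 1) * (INR k + 2))
  end.

Lemma scale_S (n : nat) : scale (S n) = scale n * ((INR n + 1) * (INR n + 2)).
Proof. reflexivity. Qed.

Lemma scale_pos (n : nat) : 0 < scale n.
Proof.
  induction n as [|n IH]; [simpl; lra|]. rewrite scale_S. pose proof (pos_INR n).
  repeat apply Rmult_lt_0_compat; lra.
Qed.

(** The scaled recurrence has limiting characteristic polynomial [x^2 - 3x + 2], with roots 1 and 2;
    the ratio 3/2 lies strictly between them and propagates. Bounding the older term by 2/3 of the
    newer one leaves a quadratic in [n] with leading coefficient [3 - 4/3 - 3/2 = 1/6]. *)
Lemma scaled_den_growth (n : nat) :
  cf_den a b n / scale n * (3 / 2) <= cf_den a b (S n) / scale (S n)
  /\ (3 / 2) ^ n / 2 <= cf_den a b (S n) / scale (S n)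
  /\ 0 <= cf_den a b n / scale n.
Proof.
  induction n as [|n [IH1 [IH2 IH3]]].
  - rewrite scale_S. simpl. lra.
  - assert (Hpow : 0 < (3 / 2) ^ n) by (apply pow_lt; lra).
    assert (Hrec : (INR n + 2) * (INR n + 3) * (cf_den a b (S (S n)) / scale (S (S n)))
      = (3 * (INR n + 1) ^ 2 + 13 * (INR n + 1) + 13) * (cf_den a b (S n) / scale (S n))
        - 2 * (INR n + 2) * (INR n + 4) * (cf_den a b n / scale n)).
    { rewrite cf_den_SS, !scale_S. unfold a, b. rewrite !S_INR.
      pose proof (pos_INR n). pose proof (scale_pos n). field. lra. }
    revert Hrec IH1 IH2 IH3.
    generalize (cf_den a b (S (S n)) / scale (S (S n))) as x2.
    generalize (cf_den a b (S n) / scale (S n)) as x1.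
    generalize (cf_den a b n / scale n) as x0.
    intros x0 x1 x2 Hrec IH1 IH2 IH3.
    pose proof (pos_INR n) as Hn. revert Hrec Hn. generalize (INR n) as t. intros t Hrec Ht.
    assert (Hx : x1 * (3 / 2) <= x2).
    { apply Rmult_le_reg_l with ((t + 2) * (t + 3)); [nra|]. rewrite Hrec.
      assert (0 <= 2 * (t + 2) * (t + 4)) by nra.
      assert (2 * (t + 2) * (t + 4) * x0 <= 2 * (t + 2) * (t + 4) * (2 / 3 * x1))
        by (apply Rmult_le_compat_l; lra).
      assert (0 <= (3 * (t + 1) ^ 2 + 13 * (t + 1) + 13 - 4 / 3 * (t + 2) * (t + 4)
                    - 3 / 2 * ((t + 2) * (t + 3))) * x1)
        by (apply Rmult_le_pos; nra).
      lra. }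
    repeat split; [exact Hx | simpl pow; lra | lra].
Qed.

(** Both sides satisfy the recurrence of the convergents, the right one by [contiguous_rec], and
    they agree at [n = 0] and [n = 1]. Induction carries two consecutive indices. *)
Lemma remainder_eq (J : nat -> R) (G : R) :
  J 0%nat = 2 * G -> J 1%nat = 2 * G - 1 ->
  (forall k, (INR k + 2) ^ 2 * J (S (S k))
             = (3 * INR k ^ 2 + 9 * INR k + 7) * J (S k) - 2 * (INR k + 1) ^ 2 * J k) ->
  forall n, (17 - 18 * G) * cf_num a b n - 6 * cf_den a b n
            = scale n * contiguous J (S n).
Proof.
  intros H0 H1 HJ.
  assert (H2 : J 2%nat = (10 * G - 7) / 4).
  { pose proof (HJ O) as H2. rewrite H0, H1 in H2. simpl in H2. lra. }
  assert (H3 : J 3%nat = (19 * J 2%nat - 8 * (2 * G - 1)) / 9).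
  { pose proof (HJ 1%nat) as H3. rewrite H1 in H3. simpl in H3. lra. }
  assert (Hpair : forall n,
    (17 - 18 * G) * cf_num a b n - 6 * cf_den a b n = scale n * contiguous J (S n)
    /\ (17 - 18 * G) * cf_num a b (S n) - 6 * cf_den a b (S n)
       = scale (S n) * contiguous J (S (S n))).
  { induction n as [|n [IH1 IH2]].
    - unfold contiguous, a. simpl. rewrite H3, H2, H1. split; field.
    - split; [exact IH2|].
      pose proof (contiguous_rec J (S n) HJ) as Hrec. rewrite S_INR in Hrec.
      pose proof (pos_INR n).
      transitivity (a (S n) * (scale (S n) * contiguous J (S (S n)))
                    + b (S n) * (scale n * contiguous J (S n))).
      + rewrite <- IH1, <- IH2, cf_num_SS, cf_den_SS. ring.
      + rewrite (scale_S (S n)), S_INR.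
        transitivity (scale (S n) * ((INR n + 1 + 1) * (INR n + 1 + 2)
                      * contiguous J (S (S (S n))))); [|ring].
        rewrite Hrec, scale_S. unfold a, b. rewrite S_INR. ring. }
  intros n. apply Hpair.
Qed.

End Convergents.

(** * Decay of the remainder and the value of the continued fraction *)

Lemma contiguous_bound (J : nat -> R) (C : R) (m : nat) :
  (forall k, 0 <= J k <= C) -> Rabs (contiguous J m) <= 11 * C * (INR m + 1) ^ 4.
Proof.
  intros HJ. unfold contiguous.
  pose proof (HJ m). pose proof (HJ (S m)). pose proof (pos_INR m) as Hm.
  revert Hm. generalize (INR m) as t. intros t Ht.
  (* Both weights are nonnegative, so the difference is bounded by the larger term. The constant 11
     is half the coefficient sum 22 of the quartic. *)
  set (al := (t ^ 4 + 6 * t ^ 3 + 8 * t ^ 2 + 5 * t + 2) / 2).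
  set (be := (t + 1) ^ 2 * (t ^ 2 + 5 * t + 2) / 2).
  assert (0 <= t ^ 2) by nra. assert (0 <= t ^ 3) by nra. assert (0 <= t ^ 4) by nra.
  assert (0 <= al <= 11 * (t + 1) ^ 4) by (unfold al; nra).
  assert (0 <= be <= 11 * (t + 1) ^ 4) by (unfold be; nra).
  apply Rabs_le. nra.
Qed.

Lemma is_lim_seq_pow4_geom : is_lim_seq (fun n => (INR n + 1) ^ 4 * (2 / 3) ^ n) 0.
Proof.
  apply ex_series_lim_0, ex_series_Rabs.
  apply ex_series_DAlembert with (2 / 3).
  - lra.
  - intros n. pose proof (pos_INR n).
    apply Rmult_integral_contrapositive_currified; apply pow_nonzero; lra.
  - apply is_lim_seq_ext with
      (* [n + 2] is written [n - - 2] to fit the shape in [is_lim_seq_homographic]. *)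
      (fun n => 2 / 3 * ((INR n - - 2) / (INR n + 1)) ^ 4).
    + intros n. pose proof (pos_INR n).
      assert (0 < (2 / 3) ^ n) by (apply pow_lt; lra).
      rewrite S_INR.
      rewrite Rabs_pos_eq.
      * simpl. field. simpl in *. split; lra.
      * apply Rdiv_le_0_compat;
          [apply Rmult_le_pos; apply pow_le; lra
          | apply Rmult_lt_0_compat; [apply pow_lt; lra | lra]].
    + replace (2 / 3) with (2 / 3 * (1 * (1 * (1 * (1 * 1))))) at 1 by ring.
      apply is_lim_seq_scal_finite.
      repeat (apply (is_lim_seq_mult' _ _ 1 _); [apply is_lim_seq_homographic|]).
      apply is_lim_seq_const.
Qed.

(** Division by [2 * lam] restores the factor [PI/2] of K, turning the values [4 * lam * Catalan]
    and [4 * lam * Catalan - 2 * lam] into those of the integrals; the recurrence is homogeneous and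
    survives. *)
Lemma moments_exist : exists (J : nat -> R) (C : R),
  J 0%nat = 2 * Catalan /\ J 1%nat = 2 * Catalan - 1 /\ (forall k, 0 <= J k <= C) /\
  forall k, (INR k + 2) ^ 2 * J (S (S k))
            = (3 * INR k ^ 2 + 9 * INR k + 7) * J (S k) - 2 * (INR k + 1) ^ 2 * J k.
Proof.
  destruct central_sq_asymptotic as [lam [Hpos Hlam]].
  exists (fun m => moment m / (2 * lam)), (moment 0 / (2 * lam)).
  assert (0 < / (2 * lam)) by (apply Rinv_0_lt_compat; lra).
  split; [|split; [|split; [intros k; split | intros k]]].
  - rewrite (moment_0 lam Hlam). field. lra.
  - rewrite (moment_1 lam Hlam), (moment_0 lam Hlam). field. lra.
  - pose proof (moment_nonneg k). unfold Rdiv. nra.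
  - pose proof (moment_le k). unfold Rdiv. nra.
  - pose proof (moment_rec k) as Hrec. unfold Rdiv.
    rewrite <- Rmult_assoc, Hrec. ring.
Qed.

Theorem corollary2p17 :
  is_CF (fun n => 3 * INR n ^ 2 + 13 * INR n + 13)
        (fun n => - 2 * INR n * (INR n + 1) ^ 2 * (INR n + 3))
        (6 / (17 - 18 * Catalan)).
Proof.
  destruct moments_exist as [J [C [H0 [H1 [HC HJ]]]]].
  pose proof (remainder_eq J Catalan H0 H1 HJ) as Hrem.
  pose proof scaled_den_growth as Hgrowth.
  revert Hrem Hgrowth.
  set (A := cf_num _ _). set (B := cf_den _ _). intros Hrem Hgrowth.
  set (g := 17 - 18 * Catalan) in *.
  assert (Hpow : forall n, 0 < (3 / 2) ^ n) by (intros n; apply pow_lt; lra).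
  assert (HB : forall n, 0 < B (S n)).
  { intros n. destruct (Hgrowth n) as [_ [Hn _]].
    specialize (Hpow n). pose proof (scale_pos (S n)).
    replace (B (S n)) with (B (S n) / scale (S n) * scale (S n)) by (field; lra).
    apply Rmult_lt_0_compat; lra. }
  (* The remainder divided by the denominator tends to 0; indices start at 1 because [B 0 = 0]. *)
  assert (Hlim : is_lim_seq (fun n => g * (A (S n) / B (S n)) - 6) 0).
  { apply is_lim_seq_abs_0.
    apply is_lim_seq_le_le with (fun _ => 0)
      (fun n => 11 * C * 81 * 2 * ((INR n + 1) ^ 4 * (2 / 3) ^ n)).
    - intros n. split; [apply Rabs_pos|].
      specialize (Hrem (S n)). destruct (Hgrowth n) as [_ [Hn _]].
      specialize (HB n). specialize (Hpow n). pose proof (scale_pos (S n)) as Hs.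
      replace (g * (A (S n) / B (S n)) - 6)
        with ((g * A (S n) - 6 * B (S n)) / B (S n)) by (field; lra).
      rewrite Hrem.
      replace (scale (S n) * contiguous J (S (S n)) / B (S n))
        with (contiguous J (S (S n)) * / (B (S n) / scale (S n))) by (field; lra).
      rewrite Rabs_mult.
      pose proof (contiguous_bound J C (S (S n)) HC) as Hc. rewrite !S_INR in Hc.
      assert (Hinv : / (B (S n) / scale (S n)) <= 2 * (2 / 3) ^ n).
      { replace (2 * (2 / 3) ^ n) with (/ ((3 / 2) ^ n / 2)).
        - apply Rinv_le_contravar; lra.
        - replace (2 / 3) with (/ (3 / 2)) by field. rewrite pow_inv. field. lra. }
      assert (0 < / (B (S n) / scale (S n))) by (apply Rinv_0_lt_compat; lra).
      rewrite (Rabs_pos_eq (/ _)) by lra.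
      assert (HC0 : 0 <= C) by (specialize (HC O); lra).
      (* [81 = 3^4] comes from [n + 3 <= 3(n + 1)]. *)
      assert (Hc' : Rabs (contiguous J (S (S n))) <= 11 * C * 81 * (INR n + 1) ^ 4).
      { eapply Rle_trans; [exact Hc|]. pose proof (pos_INR n).
        replace (11 * C * 81 * (INR n + 1) ^ 4)
          with (11 * C * (3 * (INR n + 1)) ^ 4) by ring.
        apply Rmult_le_compat_l; [lra|]. apply pow_incr. lra. }
      eapply Rle_trans.
      + apply Rmult_le_compat; [apply Rabs_pos | lra | exact Hc' | exact Hinv].
      + right. ring.
    - apply is_lim_seq_const.
    - replace 0 with (11 * C * 81 * 2 * 0) by ring.
      apply is_lim_seq_scal_finite, is_lim_seq_pow4_geom. }
  (* If [g] were 0, the sequence in [Hlim] would be constantly -6; hence [17 - 18G] is nonzero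
     without any numerical estimate of [G]. *)
  assert (Hg : g <> 0).
  { intros Hg. rewrite Hg in Hlim.
    assert (Hlim' : is_lim_seq (fun _ : nat => - 6) 0).
    { eapply is_lim_seq_ext; [|exact Hlim]. intros n. simpl. ring. }
    apply is_lim_seq_unique in Hlim'. rewrite Lim_seq_const in Hlim'.
    injection Hlim'. lra. }
  split.
  - exists 1%nat. intros [|n] Hn; [lia|]. specialize (HB n). fold B. lra.
  - fold A B. apply is_lim_seq_incr_1.
    apply is_lim_seq_ext with
      (fun n => / g * (g * (A (S n) / B (S n)) - 6 + 6)).
    + intros n. specialize (HB n). field. split; lra.
    + replace (6 / g) with (/ g * (0 + 6)) by (field; exact Hg).
      apply is_lim_seq_scal_finite, is_lim_seq_plus'; [exact Hlim | apply is_lim_seq_const].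
Qed.
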